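(* Let $(M_n)$ be a weight sequence such that $n^2M_n/M_{n+1}\to\infty$ as $n\to\infty$. Then the map $\phi:[0,1]\to[0,1]$, $\phi(x)=(1+x^2)/2$, does not induce an endomorphism of $D([0,1],M)$.
   Context: A weight sequence is a sequence $(M_n)_{n\ge 0}$ of positive real numbers with $M_0=1$ and $\frac{M_{n+m}}{M_nM_m}\ge\binom{n+m}{m}$ for all non-negative integers $m,n$. $D([0,1],M)$ is the set of complex-valued infinitely differentiable functions $f$ on $[0,1]$ (one-sided derivatives at endpoints) with $\|f\|_D=\sum_{n=0}^\infty \frac{\|f^{(n)}\|_\infty}{M_n}<\infty$, where $\|\cdot\|_\infty$ is the supremum norm on $[0,1]$; with pointwise operations and the norm $\|\cdot\|_D$ it is a unital commutative semisimple Banach algebra. A map $\phi:[0,1]\to[0,1]$ induces an endomorphism of $D([0,1],M)$ if $f\circ\phi\in D([0,1],M)$ for every $f\in D([0,1],M)$. *)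

(* Defs.v *)
From Stdlib Require Import Reals Lra.
From Coquelicot Require Import Coquelicot.
Open Scope R_scope.

Definition unit_interval (x : R) : Prop := 0 <= x <= 1.

Definition weight_sequence (M : nat -> R) : Prop :=
  (forall n : nat, 0 < M n) /\
  M 0%nat = 1 /\
  (forall m n : nat, M (n + m)%nat / (M n * M m) >= Binomial.C (n + m) m).

(** Functions on [0,1] are total functions on [R] of which only the values on
    [0,1] matter.  The filter is restricted to [0,1], so this is the one-sided
    derivative at 0 and at 1. *)
Definition is_derive01 (g : R -> C) (x : R) (l : C) : Prop :=
  @filterdiff R_AbsRing R_NormedModule C_R_NormedModule
    g (within unit_interval (locally x)) (fun h : R => scal h l).

(** [F n] is the [n]-th derivative of [f] on [0,1]; such an [F] exists iff [f]
    is infinitely differentiable there, and its values on [0,1] are unique. *)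
Definition successive_derivatives (f : R -> C) (F : nat -> R -> C) : Prop :=
  (forall x : R, unit_interval x -> F 0%nat x = f x) /\
  (forall (n : nat) (x : R), unit_interval x -> is_derive01 (F n) x (F (S n) x)).

(** [real] sends an infinite supremum to 0, but in [in_D] each [g] is
    differentiable, hence continuous and bounded, on [0,1]. *)
Definition sup_norm (g : R -> C) : R :=
  real (Lub_Rbar (fun y : R => exists x : R, unit_interval x /\ y = Cmod (g x))).

Definition in_D (M : nat -> R) (f : R -> C) : Prop :=
  exists F : nat -> R -> C,
    successive_derivatives f F /\
    ex_series (fun n : nat => sup_norm (F n) / M n).

Definition induces_endomorphism (M : nat -> R) (phi : R -> R) : Prop :=
  forall f : R -> C, in_D M f -> in_D M (fun x : R => f (phi x)).

Definition phi (x : R) : R := (1 + x ^ 2) / 2.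

Lemma phi_unit_interval (x : R) : unit_interval x -> unit_interval (phi x).
Proof. unfold unit_interval, phi; intros H; nra. Qed.

(* Main.v *)
(** The function [f x = sum_j a_j exp (l_j (x - 1))] with [a_j, l_j > 0] has
    [||f^(n)|| = f^(n) 1 = sum_j a_j l_j^n], so [||f||_D = sum_j a_j E(l_j)] where
    [E l = sum_n l^n / M_n].  As [phi 1 = phi' 1 = phi'' 1 = 1] and all terms of
    the Faa di Bruno formula at 1 are nonnegative,
    [(f o phi)^(m+1) 1 >= (m(m+1)/2) f^(m) 1], whence
    [||f o phi||_D >= sum_m b_m f^(m) 1 / M_m] with
    [b_m = m(m+1) M_m / (2 M_(m+1))], which tends to infinity by hypothesis.  For
    large [l] most of the sum [E l] comes from large [m], so there are [l_j] with
    [sum_m b_m l_j^m / M_m >= 4^j E(l_j)].  With [a_j = 2^-j / E(l_j)] the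
    function [f] lies in [D] while [||f o phi||_D >= 2^j] for every [j]. *)

Require Import Defs.
From Stdlib Require Import Reals Factorial Lra Lia IndefiniteDescription.
From Coquelicot Require Import Coquelicot.
Open Scope R_scope.

(** * Derivatives on [0,1]: quadratic remainders and uniqueness *)

(* A uniform quadratic remainder covers the endpoints of [0,1] without one-sided
   limits and is stable under the sum, product and chain rules. *)
Definition quadratic_taylor (g g' : R -> R) : Prop :=
  exists K : R, forall x y : R, unit_interval x -> unit_interval y ->
    Rabs (g' x) <= K /\ Rabs (g y - g x - g' x * (y - x)) <= K * (y - x) ^ 2.

Lemma norm_C_R (z : C) : @norm R_AbsRing C_R_NormedModule z = Cmod z.
Proof.
unfold Cmod; rewrite <- (pow2_abs (fst z)), <- (pow2_abs (snd z)); reflexivity.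
Qed.

(** Once |y - x| < eps / (K + 1), the remainder K (y - x)^2 is at most eps |y - x|; the 1 keeps the
    quotient defined when K = 0. *)
Lemma quadratic_taylor_is_derive01 (g g' : R -> R) (x : R) :
  quadratic_taylor g g' -> unit_interval x ->
  is_derive01 (fun y => RtoC (g y)) x (RtoC (g' x)).
Proof.
intros [K HK] Hx.
split; [exact (is_linear_scal_l (K := R_AbsRing) (V := C_R_NormedModule) (RtoC (g' x)))|].
intros x0 Hx0.
(* [filterdiff] speaks of every limit x0 of the filter. As x lies in [0,1], it belongs to every ball
   around x0, so x0 = x. *)
assert (E : x0 = x).
{ destruct (Req_dec x0 x) as [E|E]; [exact E|exfalso].
  assert (Hp : 0 < Rabs (x - x0)) by (apply Rabs_pos_lt; lra).
  specialize (Hx0 (ball x0 (mkposreal _ Hp)) (locally_ball x0 _)).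
  assert (Hxx := locally_singleton _ _ Hx0 Hx).
  change (Rabs (x - x0) < Rabs (x - x0)) in Hxx; lra. }
subst x0.
intros eps.
assert (HKp : 0 <= K).
{ destruct (HK x x Hx Hx) as [H _].
  generalize (Rabs_pos (g' x)); lra. }
assert (Hd : 0 < eps / (K + 1)) by (apply Rdiv_lt_0_compat; [apply cond_pos|lra]).
exists (mkposreal _ Hd); intros y Hy Iy.
change (Rabs (y - x) < eps / (K + 1)) in Hy.
destruct (HK x y Hx Iy) as [_ H].
rewrite norm_C_R.
match goal with |- Cmod ?z <= _ =>
  replace z with (RtoC (g y - g x - g' x * (y - x)))
end.
2: { unfold minus, plus, opp, scal; simpl.
     unfold RtoC, Cplus, Copp, prod_plus, prod_opp, prod_scal, plus, opp, scal, mult; simpl.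
     unfold mult; simpl.
     f_equal; ring. }
rewrite Cmod_R.
change (Rabs (g y - g x - g' x * (y - x)) <= eps * Rabs (y - x)).
apply (Rle_trans _ _ _ H).
rewrite <- (pow2_abs (y - x)).
assert (H1 : Rabs (y - x) * (K + 1) <= eps).
{ apply Rlt_le in Hy.
  apply (Rmult_le_compat_r (K + 1)) in Hy; [|lra].
  unfold Rdiv in Hy; rewrite Rmult_assoc, Rinv_l in Hy; lra. }
generalize (Rabs_pos (y - x)); nra.
Qed.

Lemma is_derive01_approx (g : R -> C) (x : R) (l : C) :
  is_derive01 g x l -> unit_interval x ->
  forall eps : posreal, exists d : posreal, forall y : R, unit_interval y ->
    Rabs (y - x) < d -> Cmod (g y - g x - RtoC (y - x) * l)%C <= eps * Rabs (y - x).
Proof.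
intros [_ H] Hx eps.
assert (Hl : is_filter_lim (within unit_interval (locally x)) x).
{ intros P HP; refine (filter_imp (F := locally x) P _ _ HP); intros y Py _; exact Py. }
destruct (H x Hl eps) as [d Hd].
exists d; intros y Iy Hy.
specialize (Hd y Hy Iy).
rewrite norm_C_R in Hd; change (norm (minus y x)) with (Rabs (y - x)) in Hd.
replace (g y - g x - RtoC (y - x) * l)%C
  with (minus (minus (g y) (g x)) (scal (minus y x) l)); [exact Hd|].
destruct (g y), (g x), l.
unfold minus, plus, opp, scal; simpl.
unfold Cminus, RtoC, Cmult, Cplus, Copp, prod_plus, prod_opp, prod_scal, plus, opp, scal, mult; simpl.
unfold mult; simpl.
f_equal; ring.
Qed.

(** Each x in [0,1] is a limit of other points y of [0,1]; subtracting the two expansions at such a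
    y gives |y - x| |l1 - l2| <= eps |y - x|. *)
Lemma is_derive01_unique (g1 g2 : R -> C) (x : R) (l1 l2 : C) :
  (forall y, unit_interval y -> g1 y = g2 y) -> unit_interval x ->
  is_derive01 g1 x l1 -> is_derive01 g2 x l2 -> l1 = l2.
Proof.
intros Heq Hx H1 H2.
assert (Hz : Cmod (l1 - l2)%C <= 0).
{ apply le_epsilon; intros eps Heps; rewrite Rplus_0_l.
  assert (He : 0 < eps / 2) by lra.
  destruct (is_derive01_approx _ _ _ H1 Hx (mkposreal _ He)) as [d1 D1].
  destruct (is_derive01_approx _ _ _ H2 Hx (mkposreal _ He)) as [d2 D2].
  assert (Hy : exists y, unit_interval y /\ 0 < Rabs (y - x) /\ Rabs (y - x) < d1
                 /\ Rabs (y - x) < d2).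
  { set (t := Rmin (1 / 2) (Rmin (d1 / 2) (d2 / 2))).
    assert (T1 : t <= 1 / 2) by apply Rmin_l.
    assert (T2 : t <= d1 / 2) by (eapply Rle_trans; [apply Rmin_r|apply Rmin_l]).
    assert (T3 : t <= d2 / 2) by (eapply Rle_trans; [apply Rmin_r|apply Rmin_r]).
    generalize (cond_pos d1) (cond_pos d2); intros P1 P2.
    assert (T4 : 0 < t) by (unfold t; repeat apply Rmin_pos; lra).
    destruct Hx as [X0 X1].
    (* Moving by t <= 1/2 away from the nearer endpoint stays inside [0,1]. *)
    destruct (Rle_dec x (1 / 2)).
    - exists (x + t); replace (x + t - x) with t by ring.
      rewrite Rabs_pos_eq by lra; unfold unit_interval; repeat split; lra.
    - exists (x - t); replace (x - t - x) with (- t) by ring.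
      rewrite Rabs_Ropp, Rabs_pos_eq by lra; unfold unit_interval; repeat split; lra. }
  destruct Hy as (y & Iy & Y0 & Y1 & Y2).
  specialize (D1 y Iy Y1); specialize (D2 y Iy Y2); simpl in D1, D2.
  rewrite !Heq in D1 by assumption.
  apply (Rmult_le_reg_l (Rabs (y - x))); [exact Y0|].
  rewrite <- (Cmod_R (y - x)) at 1; rewrite <- Cmod_mult.
  replace (RtoC (y - x) * (l1 - l2))%C
    with ((g2 y - g2 x - RtoC (y - x) * l2) + - (g2 y - g2 x - RtoC (y - x) * l1))%C
    by ring.
  eapply Rle_trans; [apply Cmod_triangle|].
  rewrite Cmod_opp; lra. }
assert (H0 : (l1 - l2)%C = 0).
{ apply Cmod_eq_0; generalize (Cmod_ge_0 (l1 - l2)%C); lra. }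
replace l1 with ((l1 - l2) + l2)%C by ring.
rewrite H0; ring.
Qed.

(** Membership in D only supplies some family of derivatives; this identifies it with an explicit
    one. *)
Lemma successive_derivatives_unique (f : R -> C) (F G : nat -> R -> C) :
  successive_derivatives f F -> successive_derivatives f G ->
  forall n x, unit_interval x -> F n x = G n x.
Proof.
intros [F0 FS] [G0 GS]; induction n as [|n IH]; intros x Hx.
- now rewrite F0, G0.
- exact (is_derive01_unique (F n) (G n) x _ _ IH Hx (FS n x Hx) (GS n x Hx)).
Qed.

(** * Calculus of quadratic remainders *)

(** Expansion at the base point 0. The bound serves the product rule and the finiteness of
    suprema. *)
Lemma quadratic_taylor_bounded (g g' : R -> R) :
  quadratic_taylor g g' -> exists K, forall x, unit_interval x -> Rabs (g x) <= K.
Proof.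
intros [K HK]; exists (Rabs (g 0) + 2 * K); intros x Hx.
assert (I0 : unit_interval 0) by (unfold unit_interval; lra).
destruct (HK 0 x I0 Hx) as [H1 H2].
rewrite Rminus_0_r in H2.
assert (Hx2 : x ^ 2 <= 1) by (destruct Hx; nra).
assert (Hk : 0 <= K) by (generalize (Rabs_pos (g' 0)); lra).
assert (H3 : Rabs (g' 0 * x) <= K).
{ rewrite Rabs_mult, (Rabs_pos_eq x) by apply Hx.
  destruct Hx; generalize (Rabs_pos (g' 0)); nra. }
replace (g x) with (g 0 + (g' 0 * x + (g x - g 0 - g' 0 * x))) by ring.
eapply Rle_trans; [apply Rabs_triang|].
apply Rplus_le_compat_l.
eapply Rle_trans; [apply Rabs_triang|].
nra.
Qed.

Lemma quadratic_taylor_plus (g g' h h' : R -> R) :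
  quadratic_taylor g g' -> quadratic_taylor h h' ->
  quadratic_taylor (fun x => g x + h x) (fun x => g' x + h' x).
Proof.
intros [K HK] [L HL]; exists (K + L); intros x y Hx Hy.
destruct (HK x y Hx Hy) as [K1 K2]; destruct (HL x y Hx Hy) as [L1 L2].
split; [eapply Rle_trans; [apply Rabs_triang|lra]|].
replace (g y + h y - (g x + h x) - (g' x + h' x) * (y - x))
  with ((g y - g x - g' x * (y - x)) + (h y - h x - h' x * (y - x))) by ring.
eapply Rle_trans; [apply Rabs_triang|lra].
Qed.

Lemma quadratic_taylor_scal (c : R) (g g' : R -> R) :
  quadratic_taylor g g' -> quadratic_taylor (fun x => c * g x) (fun x => c * g' x).
Proof.
intros [K HK]; exists (Rabs c * K); intros x y Hx Hy.
destruct (HK x y Hx Hy) as [K1 K2].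
replace (c * g y - c * g x - c * g' x * (y - x))
  with (c * (g y - g x - g' x * (y - x))) by ring.
rewrite !Rabs_mult, Rmult_assoc.
split; (apply Rmult_le_compat_l; [apply Rabs_pos|assumption]).
Qed.

Lemma quadratic_taylor_mult_id (g g' : R -> R) :
  quadratic_taylor g g' ->
  quadratic_taylor (fun x => x * g x) (fun x => g x + x * g' x).
Proof.
intros Hg; destruct (quadratic_taylor_bounded _ _ Hg) as [B HB].
destruct Hg as [K HK]; exists (B + 2 * K); intros x y Hx Hy.
destruct (HK x y Hx Hy) as [K1 K2]; specialize (HB x Hx).
assert (Hk : 0 <= K) by (generalize (Rabs_pos (g' x)); lra).
assert (Hb : 0 <= B) by (generalize (Rabs_pos (g x)); lra).
split.
- eapply Rle_trans; [apply Rabs_triang|].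
  rewrite Rabs_mult, (Rabs_pos_eq x) by apply Hx.
  destruct Hx; generalize (Rabs_pos (g' x)); nra.
- replace (y * g y - x * g x - (g x + x * g' x) * (y - x))
    with (y * (g y - g x - g' x * (y - x)) + g' x * (y - x) ^ 2) by ring.
  eapply Rle_trans; [apply Rabs_triang|].
  rewrite !Rabs_mult, (Rabs_pos_eq y), (Rabs_pos_eq ((y - x) ^ 2))
    by (apply Hy || apply pow2_ge_0).
  generalize (pow2_ge_0 (y - x)) (Rabs_pos (g y - g x - g' x * (y - x))); intros P1 P2.
  destruct Hy; nra.
Qed.

Lemma quadratic_taylor_comp_phi (g g' : R -> R) :
  quadratic_taylor g g' ->
  quadratic_taylor (fun x => g (phi x)) (fun x => x * g' (phi x)).
Proof.
intros [K HK]; exists (2 * K); intros x y Hx Hy.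
destruct (HK _ _ (phi_unit_interval x Hx) (phi_unit_interval y Hy)) as [K1 K2].
assert (Hk : 0 <= K) by (generalize (Rabs_pos (g' (phi x))); lra).
split.
- rewrite Rabs_mult, (Rabs_pos_eq x) by apply Hx.
  destruct Hx; generalize (Rabs_pos (g' (phi x))); nra.
(* Here phi y - phi x = x (y - x) + (y - x)^2 / 2 exactly; the first summand is the remainder of g
   at phi x, controlled because phi is 1-Lipschitz on [0,1]. *)
- replace (g (phi y) - g (phi x) - x * g' (phi x) * (y - x))
    with ((g (phi y) - g (phi x) - g' (phi x) * (phi y - phi x))
          + g' (phi x) * ((y - x) ^ 2 / 2)) by (unfold phi; field).
  eapply Rle_trans; [apply Rabs_triang|].
  rewrite Rabs_mult, (Rabs_pos_eq ((y - x) ^ 2 / 2))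
    by (generalize (pow2_ge_0 (y - x)); lra).
  assert (Hphi : (phi y - phi x) ^ 2 <= (y - x) ^ 2).
  { replace (phi y - phi x) with ((y - x) * ((y + x) / 2)) by (unfold phi; field).
    rewrite Rpow_mult_distr.
    assert (((y + x) / 2) ^ 2 <= 1) by (destruct Hx, Hy; nra).
    generalize (pow2_ge_0 (y - x)); nra. }
  generalize (pow2_ge_0 (y - x)); nra.
Qed.

(** * Higher derivatives of a composition with phi *)

(** [comp_phi_derive F n k] is the [n]-th derivative of [F k o phi] when [F]
    lists successive derivatives: apply Leibniz' rule to
    [(F k o phi)' = x * (F (S k) o phi)]. *)
Fixpoint comp_phi_derive (F : nat -> R -> R) (n k : nat) {struct n} : R -> R :=
  match n with
  | O => fun x => F k (phi x)
  | S m =>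
      match m with
      | O => fun x => x * F (S k) (phi x)
      | S p => fun x => x * comp_phi_derive F m (S k) x
                        + INR m * comp_phi_derive F p (S k) x
      end
  end.

Lemma comp_phi_derive_SS (F : nat -> R -> R) (n k : nat) (x : R) :
  comp_phi_derive F (S (S n)) k x
  = x * comp_phi_derive F (S n) (S k) x + INR (S n) * comp_phi_derive F n (S k) x.
Proof. reflexivity. Qed.

Lemma quadratic_taylor_ext (g g' h h' : R -> R) :
  (forall x, g x = h x) -> (forall x, g' x = h' x) ->
  quadratic_taylor g g' -> quadratic_taylor h h'.
Proof.
intros E E' [K HK]; exists K; intros x y Hx Hy.
rewrite <- !E, <- E'; now apply HK.
Qed.

(** The recursion reaches two orders back, so the induction carries two consecutive orders.
    Differentiating the factor x yields one more copy of the lower-order term, which raises its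
    coefficient by 1. *)
Lemma quadratic_taylor_comp_phi_derive (F : nat -> R -> R) :
  (forall n, quadratic_taylor (F n) (F (S n))) ->
  forall n k, quadratic_taylor (comp_phi_derive F n k) (comp_phi_derive F (S n) k).
Proof.
intros HF.
assert (H : forall n,
  (forall k, quadratic_taylor (comp_phi_derive F n k) (comp_phi_derive F (S n) k)) /\
  (forall k, quadratic_taylor (comp_phi_derive F (S n) k) (comp_phi_derive F (S (S n)) k))).
{ induction n as [|n [IH1 IH2]].
  - split; intros k.
    + exact (quadratic_taylor_comp_phi _ _ (HF k)).
    + refine (quadratic_taylor_ext _ _ _ _ _ _
        (quadratic_taylor_mult_id _ _ (quadratic_taylor_comp_phi _ _ (HF (S k)))));
      intros x; [reflexivity|].
      rewrite comp_phi_derive_SS; simpl; ring.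
  - split; [exact IH2|intros k].
    refine (quadratic_taylor_ext _ _ _ _ _ _
      (quadratic_taylor_plus _ _ _ _
        (quadratic_taylor_mult_id _ _ (IH2 (S k)))
        (quadratic_taylor_scal (INR (S n)) _ _ (IH1 (S k)))));
    intros x; [reflexivity|].
    rewrite (comp_phi_derive_SS F (S n) k), (S_INR (S n)); ring. }
intros n; apply H.
Qed.

(** At the fixed point 1 the recursion has nonnegative terms, so all but the two leading ones may be
    dropped. The coefficient of the second is a triangular number: n (n + 1) / 2 + (n + 1) = (n + 1)
    (n + 2) / 2. *)
Lemma comp_phi_derive_at_1 (F : nat -> R -> R) :
  (forall n, 0 <= F n 1) ->
  forall n k, F (n + k)%nat 1 <= comp_phi_derive F n k 1 /\
    F (S n + k)%nat 1 + INR (S n) * INR n / 2 * F (n + k)%nat 1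
    <= comp_phi_derive F (S n) k 1.
Proof.
intros HF.
assert (P1 : phi 1 = 1) by (unfold phi; field).
induction n as [|n IH]; intros k.
- simpl; rewrite P1; lra.
- assert (H : F (S n + k)%nat 1 <= comp_phi_derive F (S n) k 1).
  { destruct (IH k) as [_ H].
    generalize (HF (n + k)%nat) (pos_INR (S n)) (pos_INR n); intros A B C.
    assert (0 <= INR (S n) * INR n) by now apply Rmult_le_pos.
    assert (0 <= INR (S n) * INR n / 2 * F (n + k)%nat 1)
      by (apply Rmult_le_pos; lra).
    lra. }
  split; [exact H|].
  rewrite comp_phi_derive_SS.
  destruct (IH (S k)) as [A B].
  replace (S n + S k)%nat with (S (S n) + k)%nat in B by lia.
  replace (n + S k)%nat with (S n + k)%nat in A, B by lia.
  assert (C : INR (S n) * F (S n + k)%nat 1 <= INR (S n) * comp_phi_derive F n (S k) 1)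
    by (apply Rmult_le_compat_l; [apply pos_INR|exact A]).
  rewrite (S_INR (S n)).
  replace (INR n) with (INR (S n) - 1) in B by (rewrite S_INR; ring).
  nra.
Qed.

(** * Series with nonnegative terms *)

Lemma sum_n_nonneg (u : nat -> R) (n : nat) :
  (forall k, 0 <= u k) -> 0 <= sum_n u n.
Proof.
intros Hu; induction n as [|n IH]; [rewrite sum_O; auto|rewrite sum_Sn].
specialize (Hu (S n)); unfold plus; simpl; lra.
Qed.

Lemma sum_n_le_series (u : nat -> R) (n : nat) :
  (forall k, 0 <= u k) -> ex_series u -> sum_n u n <= Series u.
Proof.
intros Hu Hs.
refine (is_lim_seq_incr_compare (sum_n u) (Series u) (Series_correct u Hs) _ n).
intros k; rewrite sum_Sn; specialize (Hu (S k)); unfold plus; simpl; lra.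
Qed.

Lemma term_le_series (u : nat -> R) (n : nat) :
  (forall k, 0 <= u k) -> ex_series u -> u n <= Series u.
Proof.
intros Hu Hs; eapply Rle_trans; [|now apply (sum_n_le_series u n)].
assert (P := fun k => sum_n_nonneg u k Hu).
destruct n; [rewrite sum_O; lra|rewrite sum_Sn].
specialize (P n); unfold plus; simpl; lra.
Qed.

(** * Exponential sums and their derivatives *)

Lemma exp_le_1 (u : R) : u <= 0 -> exp u <= 1.
Proof.
rewrite <- exp_0; intros [H| ->]; [now apply Rlt_le, exp_increasing|lra].
Qed.

(** The tangent inequality at v makes the remainder nonnegative; the one at u bounds it by (exp u -
    exp v) (u - v), and exp is 1-Lipschitz on the nonpositive reals. *)
Lemma exp_quadratic_taylor (u v : R) :
  u <= 0 -> v <= 0 -> Rabs (exp u - exp v - exp v * (u - v)) <= (u - v) ^ 2.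
Proof.
intros Hu Hv.
assert (A : exp v * (1 + (u - v)) <= exp u).
{ replace u with (v + (u - v)) at 2 by ring; rewrite exp_plus.
  apply Rmult_le_compat_l; [apply Rlt_le, exp_pos|apply exp_ineq1_le]. }
assert (B : exp u * (1 + (v - u)) <= exp v).
{ replace v with (u + (v - u)) at 2 by ring; rewrite exp_plus.
  apply Rmult_le_compat_l; [apply Rlt_le, exp_pos|apply exp_ineq1_le]. }
assert (Eu : exp u <= 1) by now apply exp_le_1.
assert (Ev : exp v <= 1) by now apply exp_le_1.
generalize (exp_pos u) (exp_pos v); intros Pu Pv.
rewrite Rabs_pos_eq by lra.
destruct (Rle_dec u v); nra.
Qed.

(** Termwise n-th derivative of the sum of a_j exp (l_j (x - 1)). Centring at 1, the fixed point of
    phi, makes each derivative largest there when all a_j, l_j are nonnegative. *)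
Definition exp_sum (a l : nat -> R) (n : nat) (x : R) : R :=
  Series (fun j => a j * l j ^ n * exp (l j * (x - 1))).

Lemma exp_sum_term_bound (a l : nat -> R) (n j : nat) (x : R) :
  0 <= a j -> 0 <= l j -> unit_interval x ->
  0 <= a j * l j ^ n * exp (l j * (x - 1)) <= a j * l j ^ n.
Proof.
intros Ha Hl [_ Hx].
assert (P : 0 <= a j * l j ^ n) by (apply Rmult_le_pos; [|apply pow_le]; assumption).
assert (E : exp (l j * (x - 1)) <= 1) by (apply exp_le_1; nra).
generalize (exp_pos (l j * (x - 1))); split; nra.
Qed.

Lemma ex_exp_sum (a l : nat -> R) (n : nat) (x : R) :
  (forall j, 0 <= a j) -> (forall j, 0 <= l j) ->
  ex_series (fun j => a j * l j ^ n) -> unit_interval x ->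
  ex_series (fun j => a j * l j ^ n * exp (l j * (x - 1))).
Proof.
intros Ha Hl Hs Hx.
apply (ex_series_le (K := R_AbsRing) (V := R_CompleteNormedModule)
         _ (fun j => a j * l j ^ n)); [|exact Hs].
intros j; destruct (exp_sum_term_bound a l n j x (Ha j) (Hl j) Hx).
change (Rabs (a j * l j ^ n * exp (l j * (x - 1))) <= a j * l j ^ n).
rewrite Rabs_pos_eq; assumption.
Qed.

Lemma exp_sum_at_1 (a l : nat -> R) (n : nat) :
  exp_sum a l n 1 = Series (fun j => a j * l j ^ n).
Proof.
apply Series_ext; intros j.
now rewrite Rminus_diag, Rmult_0_r, exp_0, Rmult_1_r.
Qed.

Lemma exp_sum_bound (a l : nat -> R) (n : nat) (x : R) :
  (forall j, 0 <= a j) -> (forall j, 0 <= l j) ->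
  ex_series (fun j => a j * l j ^ n) -> unit_interval x ->
  Rabs (exp_sum a l n x) <= exp_sum a l n 1.
Proof.
intros Ha Hl Hs Hx; rewrite exp_sum_at_1.
assert (E := fun j => exp_sum_term_bound a l n j x (Ha j) (Hl j) Hx).
rewrite Rabs_pos_eq.
- apply Series_le; [exact E|exact Hs].
- eapply Rle_trans; [apply (E 0%nat)|].
  apply (term_le_series (fun j => a j * l j ^ n * exp (l j * (x - 1)))).
  + apply E.
  + now apply ex_exp_sum.
Qed.

(** The quadratic bound for exp applies termwise, since l_j (x - 1) <= 0; the factor (l_j (y - x))^2
    turns the sum of the bounds into the derivative of order n + 2 at 1. *)
Lemma exp_sum_quadratic_taylor (a l : nat -> R) (n : nat) :
  (forall j, 0 <= a j) -> (forall j, 0 <= l j) ->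
  (forall n, ex_series (fun j => a j * l j ^ n)) ->
  quadratic_taylor (exp_sum a l n) (exp_sum a l (S n)).
Proof.
intros Ha Hl Hs.
exists (exp_sum a l (S n) 1 + exp_sum a l (S (S n)) 1); intros x y Hx Hy.
assert (P : forall m, 0 <= exp_sum a l m 1).
{ intros m; eapply Rle_trans; [apply (Rabs_pos (exp_sum a l m 1))|].
  apply exp_sum_bound; auto; unfold unit_interval; lra. }
split.
- eapply Rle_trans; [now apply exp_sum_bound|].
  specialize (P (S (S n))); lra.
- assert (H : Rabs (exp_sum a l n y - exp_sum a l n x - exp_sum a l (S n) x * (y - x))
               <= exp_sum a l (S (S n)) 1 * (y - x) ^ 2).
  { rewrite exp_sum_at_1; unfold exp_sum.
    rewrite <- !Series_scal_r.
    assert (Ey := ex_exp_sum a l n y Ha Hl (Hs n) Hy).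
    assert (Ex := ex_exp_sum a l n x Ha Hl (Hs n) Hx).
    assert (ES := ex_series_scal_r (y - x) _ (ex_exp_sum a l (S n) x Ha Hl (Hs (S n)) Hx)).
    rewrite <- Series_minus by assumption.
    rewrite <- Series_minus; [|now apply (ex_series_minus (V := R_NormedModule))|assumption].
    assert (T : forall j,
      Rabs (a j * l j ^ n * exp (l j * (y - 1)) - a j * l j ^ n * exp (l j * (x - 1))
            - a j * l j ^ S n * exp (l j * (x - 1)) * (y - x))
      <= a j * l j ^ S (S n) * (y - x) ^ 2).
    { intros j.
      replace (a j * l j ^ n * exp (l j * (y - 1)) - a j * l j ^ n * exp (l j * (x - 1))
            - a j * l j ^ S n * exp (l j * (x - 1)) * (y - x))
        with (a j * l j ^ n *
              (exp (l j * (y - 1)) - exp (l j * (x - 1))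
               - exp (l j * (x - 1)) * (l j * (y - 1) - l j * (x - 1))))
        by (simpl; ring).
      replace (a j * l j ^ S (S n) * (y - x) ^ 2)
        with (a j * l j ^ n * (l j * (y - 1) - l j * (x - 1)) ^ 2) by (simpl; ring).
      assert (Q : 0 <= a j * l j ^ n) by (apply Rmult_le_pos; [auto|apply pow_le; auto]).
      rewrite Rabs_mult, (Rabs_pos_eq (a j * l j ^ n)) by exact Q.
      apply Rmult_le_compat_l; [exact Q|].
      specialize (Hl j); destruct Hx, Hy.
      apply exp_quadratic_taylor; nra. }
    assert (EB := ex_series_scal_r ((y - x) ^ 2) _ (Hs (S (S n)))).
    eapply Rle_trans; [apply Series_Rabs|apply Series_le; [|exact EB]].
    + apply (ex_series_le (K := R_AbsRing) (V := R_CompleteNormedModule)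
         _ (fun j => a j * l j ^ S (S n) * (y - x) ^ 2)); [|exact EB].
      intros j; unfold norm; simpl; unfold abs; simpl; rewrite Rabs_Rabsolu; apply T.
    + intros j; split; [apply Rabs_pos|apply T]. }
  eapply Rle_trans; [exact H|].
  apply Rmult_le_compat_r; [apply pow2_ge_0|].
  specialize (P (S n)); lra.
Qed.

(** * Supremum norms and the growth of weights *)

(** The bound K makes the supremum finite, so [real] returns it and not its default 0. *)
Lemma sup_norm_ge (g : R -> C) (K x : R) :
  (forall y, unit_interval y -> Cmod (g y) <= K) -> unit_interval x ->
  Cmod (g x) <= sup_norm g <= K.
Proof.
intros HK Hx; unfold sup_norm.
destruct (Lub_Rbar_correct (fun y => exists x, unit_interval x /\ y = Cmod (g x)))
  as [U L].
set (s := Lub_Rbar _) in *.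
assert (A : Rbar_le (Cmod (g x)) s) by (apply U; now exists x).
assert (B : Rbar_le s K).
{ apply L; intros y [z [Hz ->]]; now apply HK. }
destruct s; simpl in *; tauto.
Qed.

(** The weight inequality with m = 1 reads M_(n+1) >= (n+1) M_n M_1, whence M_n >= n! M_1^n. This
    compares the series of l^n / M_n with that of exp. *)
Lemma pow_div_fact_le (M : nat -> R) (l : R) (n : nat) :
  weight_sequence M -> 0 <= l ->
  l ^ n / M n <= (l / M 1%nat) ^ n / INR (fact n).
Proof.
intros (Mpos & M0 & HM) Hl.
assert (Q : 0 <= l / M 1%nat) by (apply Rdiv_le_0_compat; auto).
induction n as [|n IH]; [simpl; rewrite M0; lra|].
assert (H := HM 1%nat n).
replace (Binomial.C (n + 1) 1) with (INR (S n)) in H.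
2: { unfold Binomial.C; replace (n + 1 - 1)%nat with n by lia.
     rewrite Nat.add_1_r, fact_simpl, mult_INR; simpl fact; simpl (INR 1).
     field; apply INR_fact_neq_0. }
rewrite Nat.add_1_r in H.
generalize (Mpos n) (Mpos (S n)) (Mpos 1%nat) (lt_0_INR (S n) (Nat.lt_0_succ n))
  (INR_fact_lt_0 n); intros P PS P1 PI PF.
apply Rge_le, (Rmult_le_compat_r (M n * M 1%nat)) in H; [|nra].
unfold Rdiv in H at 1; rewrite Rmult_assoc, Rinv_l, Rmult_1_r in H by nra.
rewrite fact_simpl, mult_INR.
apply Rle_trans with (l ^ n / M n * (l / M 1%nat / INR (S n))).
- replace (l ^ n / M n * (l / M 1%nat / INR (S n)))
    with (l ^ S n / (INR (S n) * (M n * M 1%nat))) by (simpl pow; field; lra).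
  apply Rmult_le_compat_l; [now apply pow_le|].
  apply Rinv_le_contravar; [|exact H].
  apply Rmult_lt_0_compat; [lra|now apply Rmult_lt_0_compat].
- replace ((l / M 1%nat) ^ S n / (INR (S n) * INR (fact n)))
    with ((l / M 1%nat) ^ n / INR (fact n) * (l / M 1%nat / INR (S n)))
    by (simpl pow; field; lra).
  apply Rmult_le_compat_r; [apply Rdiv_le_0_compat; lra|exact IH].
Qed.

Lemma ex_series_pow_div_weight (M : nat -> R) (l : R) :
  weight_sequence M -> 0 <= l -> ex_series (fun n => l ^ n / M n).
Proof.
intros HM Hl.
apply (ex_series_le (K := R_AbsRing) (V := R_CompleteNormedModule)
         _ (fun n => (l / M 1%nat) ^ n / INR (fact n))).
- intros n; change (Rabs (l ^ n / M n) <= (l / M 1%nat) ^ n / INR (fact n)).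
  rewrite Rabs_pos_eq; [now apply pow_div_fact_le|].
  apply Rdiv_le_0_compat; [now apply pow_le|apply HM].
- exists (exp (l / M 1%nat)).
  eapply is_series_ext; [|exact (is_exp_Reals (l / M 1%nat))].
  intros n; simpl; rewrite pow_n_pow; reflexivity.
Qed.

(** * Frequencies that favour large indices *)

Lemma sum_n_pow_mult_le (l : R) (u : nat -> R) (n : nat) :
  1 <= l -> (forall k, 0 <= u k) ->
  sum_n (fun k => l ^ k * u k) n <= l ^ n * sum_n u n.
Proof.
intros Hl Hu; induction n as [|n IH]; [rewrite !sum_O; lra|rewrite !sum_Sn].
assert (P : 0 <= l ^ n * sum_n u n)
  by (apply Rmult_le_pos; [apply pow_le; lra|now apply sum_n_nonneg]).
unfold plus; simpl; nra.
Qed.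

Lemma ex_series_bounded (u : nat -> R) (K : R) :
  (forall k, 0 <= u k) -> (forall n, sum_n u n <= K) -> ex_series u.
Proof.
intros Hu HK.
destruct (ex_finite_lim_seq_incr (sum_n u) K) as [l Hl]; [|exact HK|now exists l].
intros k; rewrite sum_Sn; specialize (Hu (S k)); unfold plus; simpl; lra.
Qed.

(** Bounding the partial sums of a norm only requires exchanging a finite sum with a series. *)
Lemma ex_series_sum_n (u : nat -> nat -> R) (n : nat) :
  (forall k, ex_series (u k)) ->
  ex_series (fun j => sum_n (fun k => u k j) n) /\
  sum_n (fun k => Series (u k)) n = Series (fun j => sum_n (fun k => u k j) n).
Proof.
intros Hu; induction n as [|n [IH1 IH2]].
- split.
  + eapply ex_series_ext; [|exact (Hu 0%nat)]; intros j; now rewrite sum_O.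
  + rewrite sum_O; apply Series_ext; intros j; now rewrite sum_O.
- split.
  + eapply ex_series_ext; [|exact (ex_series_plus _ _ IH1 (Hu (S n)))].
    intros j; now rewrite sum_Sn.
  + rewrite sum_Sn, IH2; unfold plus; simpl.
    rewrite <- Series_plus by auto.
    apply Series_ext; intros j; now rewrite sum_Sn.
Qed.

(** For l >= 0 this is the norm in D of exp (l (x - 1)). *)
Definition weight_gf (M : nat -> R) (l : R) : R := Series (fun n => l ^ n / M n).

(* As [l] grows the mass of [l ^ m / M m] moves to large [m], where the factor
   [b m] is large. *)
Lemma weighted_series_large (M b : nat -> R) (B : R) :
  weight_sequence M -> (forall m, 0 <= b m) -> is_lim_seq b p_infty -> 0 <= B ->
  exists l, 0 < l /\
    forall K, (forall N, sum_n (fun m => l ^ m / M m * b m) N <= K) ->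
      B * weight_gf M l <= K.
Proof.
intros HM Hb Hlim HB.
assert (Mpos := proj1 HM).
apply is_lim_seq_spec in Hlim.
(* The factor 2 compensates for discarding the head, which will carry at most half of the mass. *)
destruct (Hlim (2 * B)) as [p Hp].
set (s := sum_n (fun m => / M m) p).
assert (Hs : 0 <= s).
{ apply sum_n_nonneg; intros k; apply Rlt_le, Rinv_0_lt_compat, Mpos. }
(* With l >= 1 and l >= M_(p+1) s, the head is at most l^p s <= l^(p+1) / M_(p+1), a single term of
   the tail. *)
set (l := 1 + M (S p) * s).
assert (Hl : 1 <= l) by (unfold l; specialize (Mpos (S p)); nra).
(* Upper bounds K of the partial sums stand in for the weighted series, which may diverge. *)
exists l; split; [lra|]; intros K HK.
set (t := fun m => l ^ m / M m).
assert (Ht : forall m, 0 <= t m) by (intros m; apply Rdiv_le_0_compat; [apply pow_le; lra|apply Mpos]).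
assert (Es : ex_series t) by (apply ex_series_pow_div_weight; [exact HM|lra]).
assert (Hhead : sum_n t p <= t (S p)).
{ apply Rle_trans with (l ^ p * s).
  - apply (sum_n_pow_mult_le l (fun m => / M m)); [exact Hl|].
    intros k; apply Rlt_le, Rinv_0_lt_compat, Mpos.
  - unfold t; simpl pow.
    apply (Rmult_le_reg_r (M (S p))); [auto|].
    unfold Rdiv; rewrite !Rmult_assoc, Rinv_l, Rmult_1_r by apply Rgt_not_eq, Mpos.
    rewrite (Rmult_comm l), (Rmult_comm s).
    apply Rmult_le_compat_l; [apply pow_le; lra|unfold l; lra]. }
assert (HE : 2 * sum_n t p <= Series t).
{ generalize (sum_n_le_series t (S p) Ht Es); rewrite sum_Sn; unfold plus; simpl; lra. }
assert (Hsum : forall N, (p <= N)%nat ->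
   2 * B * (sum_n t N - sum_n t p) <= sum_n (fun m => t m * b m) N).
{ intros N HN; induction HN as [|N HN IH].
  - rewrite Rminus_diag, Rmult_0_r; apply sum_n_nonneg.
    intros k; now apply Rmult_le_pos.
  - rewrite !sum_Sn; unfold plus; simpl.
    specialize (Hp (S N) ltac:(lia)); specialize (Ht (S N)); nra. }
assert (Hfin : 2 * B * (Series t - sum_n t p) <= K).
{ apply (is_lim_seq_le_loc (fun N => 2 * B * (sum_n t N - sum_n t p)) (fun _ => K)
    (2 * B * (Series t - sum_n t p)) K).
  - exists p; intros N HN; eapply Rle_trans; [now apply Hsum|apply HK].
  - apply (is_lim_seq_scal_l _ (2 * B) (Series t - sum_n t p)).
    apply is_lim_seq_minus'; [exact (Series_correct t Es)|apply is_lim_seq_const].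
  - apply is_lim_seq_const. }
change (B * Series t <= K); nra.
Qed.

(** * Exponential sums in D and their compositions with phi *)

Lemma pow_le_weight_gf (M : nat -> R) (l : R) (n : nat) :
  weight_sequence M -> 0 <= l -> l ^ n <= M n * weight_gf M l.
Proof.
intros HM Hl.
assert (Mpos := proj1 HM n).
assert (H : l ^ n / M n <= weight_gf M l).
{ apply (term_le_series (fun n => l ^ n / M n)).
  - intros k; apply Rdiv_le_0_compat; [now apply pow_le|apply HM].
  - now apply ex_series_pow_div_weight. }
apply (Rmult_le_compat_l (M n)) in H; [|lra].
replace (M n * (l ^ n / M n)) with (l ^ n) in H by (field; lra); exact H.
Qed.

(** Domination by M_n times the convergent series, as l^n <= M_n E(l). *)
Lemma ex_series_coeff_pow (M a l : nat -> R) (n : nat) :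
  weight_sequence M -> (forall j, 0 <= a j) -> (forall j, 0 <= l j) ->
  ex_series (fun j => a j * weight_gf M (l j)) ->
  ex_series (fun j => a j * l j ^ n).
Proof.
intros HM Ha Hl Hs.
apply (ex_series_le (K := R_AbsRing) (V := R_CompleteNormedModule)
         _ (fun j => a j * weight_gf M (l j) * M n)).
- intros j; change (Rabs (a j * l j ^ n) <= a j * weight_gf M (l j) * M n).
  rewrite Rabs_pos_eq by (apply Rmult_le_pos; [auto|apply pow_le; auto]).
  rewrite Rmult_assoc, (Rmult_comm (weight_gf M (l j))).
  apply Rmult_le_compat_l; [auto|now apply pow_le_weight_gf].
- now apply ex_series_scal_r.
Qed.

Lemma successive_derivatives_of_real (F : nat -> R -> R) :
  (forall n, quadratic_taylor (F n) (F (S n))) ->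
  successive_derivatives (fun x => RtoC (F 0%nat x)) (fun n x => RtoC (F n x)).
Proof.
intros HF; split; [reflexivity|].
intros n x Hx; now apply quadratic_taylor_is_derive01.
Qed.

(** Each supremum is bounded by the value at 1; after exchanging sums, the partial sums of the norm
    are at most the sum of a_j E(l_j). *)
Lemma exp_sum_in_D (M a l : nat -> R) :
  weight_sequence M -> (forall j, 0 <= a j) -> (forall j, 0 <= l j) ->
  ex_series (fun j => a j * weight_gf M (l j)) ->
  in_D M (fun x => RtoC (exp_sum a l 0 x)).
Proof.
intros HM Ha Hl Hs.
assert (Mpos := proj1 HM).
assert (Hc := fun n => ex_series_coeff_pow M a l n HM Ha Hl Hs).
exists (fun n x => RtoC (exp_sum a l n x)); split.
{ apply successive_derivatives_of_real; intros n; now apply exp_sum_quadratic_taylor. }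
assert (I1 : unit_interval 1) by (unfold unit_interval; lra).
assert (Hsup : forall n,
  0 <= sup_norm (fun x => RtoC (exp_sum a l n x)) <= Series (fun j => a j * l j ^ n)).
{ intros n; rewrite <- exp_sum_at_1.
  destruct (sup_norm_ge (fun x => RtoC (exp_sum a l n x)) (exp_sum a l n 1) 1) as [A B].
  - intros y Hy; rewrite Cmod_R; now apply exp_sum_bound.
  - exact I1.
  - split; [|exact B].
    eapply Rle_trans; [apply Cmod_ge_0|exact A]. }
apply (ex_series_bounded _ (Series (fun j => a j * weight_gf M (l j)))).
{ intros n; apply Rdiv_le_0_compat; [apply Hsup|apply Mpos]. }
intros N.
assert (Hu : forall n, ex_series (fun j => a j * l j ^ n * / M n))
  by (intros n; now apply ex_series_scal_r).
apply Rle_trans with (sum_n (fun n => Series (fun j => a j * l j ^ n * / M n)) N).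
- apply sum_n_m_le; intros n; rewrite Series_scal_r.
  apply Rmult_le_compat_r; [apply Rlt_le, Rinv_0_lt_compat, Mpos|apply Hsup].
- rewrite (proj2 (ex_series_sum_n _ N Hu)).
  apply Series_le; [|exact Hs].
  intros j; split.
  + apply sum_n_nonneg; intros n.
    apply Rmult_le_pos; [apply Rmult_le_pos; [auto|now apply pow_le]|].
    apply Rlt_le, Rinv_0_lt_compat, Mpos.
  + rewrite (sum_n_ext _ (fun n => mult (a j) (l j ^ n / M n)))
      by (intros n; unfold mult; simpl; unfold Rdiv; ring).
    rewrite (sum_n_mult_l (K := R_Ring)).
    apply Rmult_le_compat_l; [auto|].
    apply (sum_n_le_series (fun n => l j ^ n / M n)).
    * intros n; apply Rdiv_le_0_compat; [now apply pow_le|apply Mpos].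
    * now apply ex_series_pow_div_weight.
Qed.

(** The bound is the norm of f o phi, hence uniform in j and N. From each derivative at 1 only the
    second leading term is kept, and in it only the j-th exponential. *)
Lemma comp_phi_in_D_bound (M a l : nat -> R) :
  weight_sequence M -> (forall j, 0 <= a j) -> (forall j, 0 <= l j) ->
  ex_series (fun j => a j * weight_gf M (l j)) ->
  in_D M (fun x => RtoC (exp_sum a l 0 (phi x))) ->
  exists S0, forall j N,
    sum_n (fun m => a j * (l j ^ m / M m * (INR (S m) * INR m / 2 * M m / M (S m)))) N <= S0.
Proof.
intros HM Ha Hl Hs [G [HG HGs]].
assert (Mpos := proj1 HM).
assert (Hc := fun n => ex_series_coeff_pow M a l n HM Ha Hl Hs).
set (F := exp_sum a l).
assert (HT : forall n, quadratic_taylor (comp_phi_derive F n 0) (comp_phi_derive F (S n) 0)).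
{ intros n; apply quadratic_taylor_comp_phi_derive.
  intros k; now apply exp_sum_quadratic_taylor. }
assert (HGH := successive_derivatives_unique _ _ _ HG
  (successive_derivatives_of_real (fun n => comp_phi_derive F n 0) HT)).
assert (I1 : unit_interval 1) by (unfold unit_interval; lra).
assert (Hsup : forall n, comp_phi_derive F n 0 1 <= sup_norm (G n) /\ 0 <= sup_norm (G n)).
{ intros n; destruct (quadratic_taylor_bounded _ _ (HT n)) as [K HK].
  destruct (sup_norm_ge (G n) K 1) as [A _].
  - intros y Hy; rewrite HGH, Cmod_R by exact Hy; now apply HK.
  - exact I1.
  - split; [|eapply Rle_trans; [apply Cmod_ge_0|exact A]].
    rewrite HGH, Cmod_R in A by exact I1.
    eapply Rle_trans; [apply Rle_abs|exact A]. }
assert (HF : forall n j, 0 <= a j * l j ^ n <= F n 1).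
{ intros n j.
  assert (P : forall j, 0 <= a j * l j ^ n)
    by (intros i; apply Rmult_le_pos; [auto|now apply pow_le]).
  split; [apply P|].
  unfold F; rewrite exp_sum_at_1.
  now apply (term_le_series (fun j => a j * l j ^ n)). }
exists (Series (fun n => sup_norm (G n) / M n)); intros j N.
assert (Hpos : forall n, 0 <= sup_norm (G n) / M n)
  by (intros n; apply Rdiv_le_0_compat; [apply Hsup|apply Mpos]).
apply Rle_trans with (sum_n (fun m => sup_norm (G (S m)) / M (S m)) N).
- apply sum_n_m_le; intros m.
  replace (a j * (l j ^ m / M m * (INR (S m) * INR m / 2 * M m / M (S m))))
    with (INR (S m) * INR m / 2 * (a j * l j ^ m) / M (S m))
    by (field; split; apply Rgt_not_eq, Mpos).
  apply Rmult_le_compat_r; [apply Rlt_le, Rinv_0_lt_compat, Mpos|].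
  eapply Rle_trans; [|exact (proj1 (Hsup (S m)))].
  destruct (comp_phi_derive_at_1 F) with (n := m) (k := 0%nat) as [_ A].
  + intros n; destruct (HF n 0%nat); lra.
  + rewrite !Nat.add_0_r in A.
    eapply Rle_trans; [|exact A].
    rewrite <- (Rplus_0_l (_ * (a j * l j ^ m))).
    apply Rplus_le_compat; [destruct (HF (S m) j); lra|].
    apply Rmult_le_compat_l; [|apply HF].
    generalize (Rmult_le_pos _ _ (pos_INR (S m)) (pos_INR m)); lra.
- eapply Rle_trans; [|apply (sum_n_le_series _ (S N) Hpos HGs)].
  (* The orders m + 1 with m <= N are the orders up to N + 1 without order 0, whose term is
     nonnegative. *)
  unfold sum_n at 2; rewrite sum_Sn_m, <- sum_n_m_S by lia.
  specialize (Hpos 0%nat); unfold plus; simpl; unfold sum_n; lra.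
Qed.

(** * Choice of coefficients and contradiction *)

Theorem theorem3p2 (M : nat -> R)
    (hM : weight_sequence M)
    (hlim : is_lim_seq (fun n : nat => INR n ^ 2 * M n / M (S n)) p_infty) :
  ~ induces_endomorphism M phi.
Proof.
intros Hind.
assert (Mpos := proj1 hM).
set (b := fun m => INR (S m) * INR m / 2 * M m / M (S m)).
assert (Hq : forall m, 0 < M m / M (S m)) by (intros m; apply Rdiv_lt_0_compat; auto).
assert (Hb : forall m, 0 <= b m).
{ intros m; unfold b; apply Rdiv_le_0_compat; [|auto].
  generalize (Rmult_le_pos _ _ (pos_INR (S m)) (pos_INR m)) (Mpos m).
  intros; apply Rmult_le_pos; lra. }
(* As m (m + 1) / 2 >= m^2 / 2, b_m is at least half the sequence of the hypothesis; hence the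
   threshold 2 B. *)
assert (Hblim : is_lim_seq b p_infty).
{ apply is_lim_seq_spec; apply is_lim_seq_spec in hlim; intros B.
  destruct (hlim (2 * B)) as [p Hp]; exists p; intros m Hm.
  specialize (Hp m Hm); specialize (Hq m); unfold b.
  replace (INR m ^ 2 * M m / M (S m)) with (INR m ^ 2 * (M m / M (S m))) in Hp
    by (unfold Rdiv; ring).
  replace (INR (S m) * INR m / 2 * M m / M (S m))
    with ((INR m ^ 2 + INR m) / 2 * (M m / M (S m)))
    by (rewrite S_INR; unfold Rdiv; ring).
  generalize (pos_INR m); nra. }
destruct (functional_choice (fun (j : nat) (l : R) => 0 < l /\
    forall K, (forall N, sum_n (fun m => l ^ m / M m * b m) N <= K) ->
      4 ^ j * weight_gf M l <= K)) as [l Hl].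
{ intros j; apply weighted_series_large; auto; apply pow_le; lra. }
assert (Hl0 : forall j, 0 <= l j) by (intros j; apply Rlt_le, Hl).
assert (HE : forall j, 0 < weight_gf M (l j)).
{ intros j; generalize (pow_le_weight_gf M (l j) 0 hM (Hl0 j)).
  rewrite (proj1 (proj2 hM)); simpl; lra. }
(* Now a_j E(l_j) = 2^-j is summable, while a_j times the lower bound 4^j E(l_j) is 2^j. *)
set (a := fun j => (1 / 2) ^ j / weight_gf M (l j)).
assert (Hh : forall j, 0 < (1 / 2) ^ j) by (intros j; apply pow_lt; lra).
assert (Ha : forall j, 0 < a j) by (intros j; now apply Rdiv_lt_0_compat).
assert (Ha0 : forall j, 0 <= a j) by (intros j; now apply Rlt_le).
assert (Hs : ex_series (fun j => a j * weight_gf M (l j))).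
{ apply (ex_series_ext (fun j => (1 / 2) ^ j)).
  - intros j; change ((1 / 2) ^ j = (1 / 2) ^ j / weight_gf M (l j) * weight_gf M (l j)).
    field; apply Rgt_not_eq, HE.
  - apply ex_series_geom; rewrite Rabs_pos_eq; lra. }
destruct (comp_phi_in_D_bound M a l hM Ha0 Hl0 Hs) as [K HK].
{ exact (Hind _ (exp_sum_in_D M a l hM Ha0 Hl0 Hs)). }
assert (Hbig : forall j, 2 ^ j <= K).
{ intros j.
  (* K bounds the sums that include the factor a_j, so K / a_j bounds the weighted partial sums at
     l_j. *)
  assert (H : 4 ^ j * weight_gf M (l j) <= K / a j).
  { apply Hl; intros N.
    apply (Rmult_le_reg_l (a j)); [apply Ha|].
    replace (a j * (K / a j)) with K by (field; apply Rgt_not_eq, Ha).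
    rewrite <- (sum_n_mult_l (K := R_Ring)).
    exact (HK j N). }
  apply (Rmult_le_compat_l (a j)) in H; [|apply Ha0].
  replace (a j * (K / a j)) with K in H by (field; apply Rgt_not_eq, Ha).
  replace (a j * (4 ^ j * weight_gf M (l j))) with (2 ^ j) in H; [exact H|].
  unfold a; replace 4 with (2 * 2) by ring; rewrite Rpow_mult_distr.
  transitivity (((1 / 2) ^ j * 2 ^ j) * 2 ^ j); [|field; apply Rgt_not_eq, HE].
  rewrite <- Rpow_mult_distr; replace (1 / 2 * 2) with 1 by field.
  now rewrite pow1, Rmult_1_l. }
destruct (Pow_x_infinity 2 ltac:(rewrite Rabs_pos_eq; lra) (K + 1)) as [j Hj].
specialize (Hj j (le_n j)); specialize (Hbig j).
rewrite Rabs_pos_eq in Hj by (apply pow_le; lra); lra.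
Qed.
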